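(* Let $I=[a,b]$ be a compact interval, let $0<\alpha<1$, let $g:I\to\mathbb R$ be an arbitrary function, and let $F:I\to\mathcal K_c(\mathbb R)$ be $g$-Hölder of exponent $\alpha$. For every $\theta\in I$ and every $x_\theta\in F(\theta)$, there exists $f:I\to\mathbb R$ with $f(t)\in F(t)$ for every $t\in I$ such that $$f(\theta)=x_\theta,\qquad[f]_{\alpha,g}\le[F]_{\alpha,g}.$$
   Context: $\mathcal K_c(\mathbb R)$ is the family of nonempty compact convex subsets of $\mathbb R$, with Hausdorff distance $d_H$. $F$ is $g$-Hölder of exponent $\alpha$ if there is $L\ge0$ with $d_H(F(s),F(t))\le L|g(t)-g(s)|^\alpha$ for all $s,t\in I$; $[F]_{\alpha,g}$ is the minimum such $L$. $[f]_{\alpha,g}$ is the minimum $L\ge0$ with $|f(s)-f(t)|\le L|g(t)-g(s)|^\alpha$ for all $s,t\in I$. *)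

(* Defs.v *)
From HB Require Import structures.
From mathcomp Require Import all_boot all_order all_algebra.
From mathcomp Require Import all_classical all_reals all_analysis.

Set Implicit Arguments.
Unset Strict Implicit.
Unset Printing Implicit Defensive.

Import Order.TTheory GRing.Theory Num.Theory numFieldNormedType.Exports.

Local Open Scope classical_set_scope.
Local Open Scope ring_scope.

(* The family K_c(R) of nonempty compact convex subsets of the real line;
   [R^o] is R seen as a module over itself, as [convex_set] requires. *)
Definition Kc (R : realType) : set (set R) :=
  [set A | [/\ A !=set0, compact A & convex_set (A : set R^o)]].

(* [sup] and [inf] are the real-valued ones: they have their usual meaning when
   A and B are nonempty and bounded, in particular on K_c(R). *)
Definition hausdorff_excess (R : realType) (A B : set R) : R :=
  sup [set inf [set `|x - y| | y in B] | x in A].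

Definition hausdorff_dist (R : realType) (A B : set R) : R :=
  Num.max (hausdorff_excess A B) (hausdorff_excess B A).

(* Functions on I are represented by total functions of which only the values
   on I matter. As alpha > 0 in all uses, 0 `^ alpha = 0. *)
Definition holder_bounds (R : realType) (T : Type) (dist : T -> T -> R)
    (I : set R) (alpha : R) (g : R -> R) (F : R -> T) : set R :=
  [set L | 0 <= L /\ forall s t, I s -> I t ->
     dist (F s) (F t) <= L * `|g t - g s| `^ alpha].

Definition g_holder (R : realType) (T : Type) (dist : T -> T -> R)
    (I : set R) (alpha : R) (g : R -> R) (F : R -> T) : Prop :=
  holder_bounds dist I alpha g F !=set0.

(* The minimum of [holder_bounds], attained as soon as there is some bound
   ([holder_const_min]); it is a junk value otherwise, so that a statement
   about [holder_const] must be accompanied by [g_holder]. *)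
Definition holder_const (R : realType) (T : Type) (dist : T -> T -> R)
    (I : set R) (alpha : R) (g : R -> R) (F : R -> T) : R :=
  inf (holder_bounds dist I alpha g F).

Definition real_dist (R : realType) (x y : R) : R := `|x - y|.

Lemma holder_const_min (R : realType) (T : Type) (dist : T -> T -> R)
    (I : set R) (alpha : R) (g : R -> R) (F : R -> T) :
  g_holder dist I alpha g F ->
  holder_bounds dist I alpha g F (holder_const dist I alpha g F) /\
  lbound (holder_bounds dist I alpha g F) (holder_const dist I alpha g F).
Proof.
move=> hF; have lb0 : lbound (holder_bounds dist I alpha g F) 0.
  by move=> L [].
have hlb : has_lbound (holder_bounds dist I alpha g F) by exists 0.
split; last by move=> L HL; exact: ge_inf.
split=> [|s t Is It]; first exact: lb_le_inf.
have := powR_ge0 `|g t - g s| alpha; rewrite le_eqVlt => /orP[/eqP p0|p_gt0].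
  by case: hF => L [_ /(_ s t Is It)]; rewrite -p0 !mulr0.
rewrite -ler_pdivrMr//; apply: lb_le_inf => // L [_ /(_ s t Is It)].
by rewrite ler_pdivrMr.
Qed.

(* Main.v *)
(** A set in K_c(R) is a segment, and both of its endpoints are 1-Lipschitz for
the Hausdorff distance. The selection is the projection of the fixed point [x]
onto F(t), i.e. [x] clamped between the endpoints of F(t); since min and max
are nonexpansive for the sup norm, it inherits every Hölder bound of F. *)
Require Import Defs.
From HB Require Import structures.
From mathcomp Require Import all_boot all_order all_algebra.
From mathcomp Require Import all_classical all_reals all_analysis.
From mathcomp Require Import ring lra.

Import Order.TTheory GRing.Theory Num.Theory numFieldNormedType.Exports.

Local Open Scope classical_set_scope.
Local Open Scope ring_scope.

Lemma convex_set_between (R : realType) (A : set R) (m M z : R) :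
  convex_set (A : set R^o) -> A m -> A M -> m <= z <= M -> A z.
Proof.
move=> cA Am AM /andP[mz zM].
have := le_trans mz zM; rewrite le_eqVlt => /orP[/eqP mM|mM].
  by have -> : z = m by lra.
(* The weight on [m] solves [z = t * m + (1 - t) * M]; the degenerate case [m = M] is settled, so
   the denominator is positive. *)
have t0 : 0 <= (M - z) / (M - m) by rewrite divr_ge0 ?subr_ge0// ltW.
have t1 : (M - z) / (M - m) <= 1 by rewrite ler_pdivrMr ?subr_gt0// mul1r; lra.
pose t := (M - z) / (M - m).
have /set_mem : (t * m + (1 - t) * M) \in A.
  by apply: (cA m M (Itv01 t0 t1)); exact: mem_set.
by congr A; rewrite /t; field; lra.
Qed.

(** The identity attains its minimum and maximum on the nonempty compact set [A], and convexity
    fills in the points between them. *)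
Lemma Kc_segment (R : realType) (A : set R) :
  Kc A -> exists m M, m <= M /\ A = `[m, M]%classic.
Proof.
move=> [A0 Ac cA].
have idA : {within A, continuous (@idfun R)}
  by apply: continuous_subspaceT => ?; exact: cvg_id.
have [m] := compact_EVT_min A0 Ac idA; rewrite inE => Am mle.
have [M] := compact_EVT_max A0 Ac idA; rewrite inE => AM leM.
exists m, M; split; first by apply: mle; rewrite inE.
apply/seteqP; split=> z /=; rewrite in_itv/=.
  by move=> Az; rewrite mle ?leM ?inE.
exact: convex_set_between.
Qed.

(** One point of [A] far from all of [B] already forces a large excess. *)
Lemma ge_hausdorff_excess (R : realType) (A B : set R) (c d : R) :
  Kc A -> B !=set0 -> A c -> (forall y, B y -> d <= `|c - y|) ->
  d <= hausdorff_excess A B.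
Proof.
move=> /Kc_segment[m [M [_ ->]]] [y0 By0] Ac dB.
apply: (@le_trans _ _ (inf [set `|c - y| | y in B])).
  apply: lb_le_inf; first by exists `|c - y0|, y0.
  by move=> _ [y By <-]; exact: dB.
apply: ub_le_sup; last by exists c.
(* The real [sup] is meaningful only for a bounded set. Each infimum is at most the distance to the
   fixed point [y0], and [x - y0] lies between [m - y0] and [M - y0]. *)
exists (`|y0 - m| + `|M - y0|) => _ [x + <-].
rewrite /= in_itv/= => /andP[mx xM].
apply: (@le_trans _ _ `|x - y0|).
  by apply: ge_inf; [exists 0 => _ [y _ <-] | exists y0].
have := ler_norm (y0 - m); have := ler_norm (M - y0).
have := normr_ge0 (y0 - m); have := normr_ge0 (M - y0).
by rewrite ler_norml => *; apply/andP; split; lra.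
Qed.

Lemma hausdorff_distC (R : realType) (A B : set R) :
  hausdorff_dist A B = hausdorff_dist B A.
Proof. by rewrite /hausdorff_dist maxC. Qed.

(** By symmetry the minimum of [A] may be taken to the left of that of [B]; it is then at least
    [inf B - inf A] away from every point of [B]. *)
Lemma inf_hausdorff_dist (R : realType) (A B : set R) :
  Kc A -> Kc B -> `|inf A - inf B| <= hausdorff_dist A B.
Proof.
wlog: A B / inf A <= inf B => [hw KA KB|].
  have [/hw|/ltW/hw] := leP (inf A) (inf B); first exact.
  by rewrite distrC hausdorff_distC; exact.
move=> AB KA KB; rewrite /hausdorff_dist le_max; apply/orP; left.
move: (KA) (KB) AB => /Kc_segment[m [M [mM Aeq]]] /Kc_segment[n [N [nN Beq]]].
have -> : inf A = m by rewrite Aeq inf_itvcc.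
have -> : inf B = n by rewrite Beq inf_itvcc.
move=> mn; apply: (@ge_hausdorff_excess _ A B m) => //.
- by case: KB.
- by rewrite Aeq /= in_itv/= lexx.
- move=> y; rewrite Beq /= in_itv/= => /andP[ny _].
  by rewrite !ler0_norm; lra.
Qed.

(** Mirror image of the bound for [inf]: the witness is the larger of the two maxima. *)
Lemma sup_hausdorff_dist (R : realType) (A B : set R) :
  Kc A -> Kc B -> `|sup A - sup B| <= hausdorff_dist A B.
Proof.
wlog: A B / sup B <= sup A => [hw KA KB|].
  have [/hw|/ltW/hw] := leP (sup B) (sup A); first exact.
  by rewrite distrC hausdorff_distC; exact.
move=> AB KA KB; rewrite /hausdorff_dist le_max; apply/orP; left.
move: (KA) (KB) AB => /Kc_segment[m [M [mM Aeq]]] /Kc_segment[n [N [nN Beq]]].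
have -> : sup A = M by rewrite Aeq sup_itvcc.
have -> : sup B = N by rewrite Beq sup_itvcc.
move=> mn; apply: (@ge_hausdorff_excess _ A B M) => //.
- by case: KB.
- by rewrite Aeq /= in_itv/= lexx andbT.
- move=> y; rewrite Beq /= in_itv/= => /andP[_ yN].
  by rewrite !ger0_norm; lra.
Qed.

Lemma ler_dist_clamp (R : realDomainType) (m M m' M' x d : R) :
  `|m - m'| <= d -> `|M - M'| <= d ->
  `|Num.max m (Num.min M x) - Num.max m' (Num.min M' x)| <= d.
Proof.
rewrite !ler_norml => /andP[m1 m2] /andP[M1 M2].
(* Deciding every [min] and [max] leaves sixteen cases, each linear. *)
have [|] := leP M x => ?; have [|] := leP M' x => ?;
have [|] := leP m => ?; have [|] := leP m' => ?;
by apply/andP; split; lra.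
Qed.

Theorem proposition11p2 (R : realType) (a b : R) (hab : a <= b)
    (alpha : R) (halpha0 : 0 < alpha) (halpha1 : alpha < 1)
    (g : R -> R) (F : R -> set R)
    (hFKc : forall t, `[a, b]%classic t -> Kc (F t))
    (hF : g_holder (@hausdorff_dist R) `[a, b]%classic alpha g F)
    (theta : R) (htheta : `[a, b]%classic theta) (x : R) (hx : F theta x) :
  exists f : R -> R,
    [/\ forall t, `[a, b]%classic t -> F t (f t),
        f theta = x,
        g_holder (@real_dist R) `[a, b]%classic alpha g f &
        holder_const (@real_dist R) `[a, b]%classic alpha g f
          <= holder_const (@hausdorff_dist R) `[a, b]%classic alpha g F].
Proof.
pose f t := Num.max (inf (F t)) (Num.min (sup (F t)) x).
have [[L0 hL] _] := holder_const_min hF.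
set L := holder_const _ _ _ _ F in L0 hL *.
(* The least constant of [F] is itself a bound for [f]; this gives both that [f] is Hölder and the
   comparison of the two minima. *)
have fL : holder_bounds (@real_dist R) `[a, b]%classic alpha g f L.
  split=> // s t Is It; apply: le_trans (hL s t Is It).
  by apply: ler_dist_clamp;
    [apply: inf_hausdorff_dist|apply: sup_hausdorff_dist]; exact: hFKc.
have fholder : g_holder (@real_dist R) `[a, b]%classic alpha g f by exists L.
exists f; split => //; last by case: (holder_const_min fholder) => _; exact.
- move=> t It; have [m [M [mM Feq]]] := Kc_segment _ _ (hFKc t It).
  rewrite /f Feq inf_itvcc// sup_itvcc//= in_itv/= le_max lexx/=.
  by rewrite ge_max mM ge_min lexx.
- have [m [M [mM Feq]]] := Kc_segment _ _ (hFKc theta htheta).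
  move: hx; rewrite /f Feq inf_itvcc// sup_itvcc//= in_itv/= => /andP[mx xM].
  by rewrite (min_idPr xM) (max_idPr mx).
Qed.
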